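(* Let $R$ be a nonzero ring. If $r \in R$ is a $\sqrt{\Delta}$-fine element, then $RrR = R$, where $RrR$ is the two-sided ideal generated by $r$. In particular, if $R$ is a $\sqrt{\Delta}$-fine ring, then $R$ is a simple ring.
   Context: Rings are associative with identity, not necessarily commutative. For a ring $R$, $U(R)$ is its group of units. Define $\Delta(R) = \{a \in R : 1 - ua \in U(R) \text{ for every } u \in U(R)\}$ and $\sqrt{\Delta(R)} = \{x \in R : x^m \in \Delta(R) \text{ for some integer } m \ge 1\}$. A nonzero element $r \in R$ is called $\sqrt{\Delta}$-fine if $r = u + a$ for some $u \in U(R)$ and $a \in \sqrt{\Delta(R)}$. The ring $R$ is called $\sqrt{\Delta}$-fine if every nonzero element of $R$ is $\sqrt{\Delta}$-fine. A simple ring is a nonzero ring whose only two-sided ideals are $0$ and itself. *)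

(* Defs.v *)
From mathcomp Require Import all_boot all_algebra.
From mathcomp Require Import boolp classical_sets.

Set Implicit Arguments.
Unset Strict Implicit.
Unset Printing Implicit Defensive.

Import GRing.Theory.
Local Open Scope classical_set_scope.
Local Open Scope ring_scope.

(* Units are defined for every ring, without the computable inverse required
   by unitRingType; see unitsE for the agreement with GRing.unit. *)
Definition units (R : pzRingType) : set R :=
  [set u | exists v : R, v * u = 1 /\ u * v = 1].

Lemma unitsE (R : unitRingType) (u : R) : units u <-> u \is a GRing.unit.
Proof. by split=> /unitrP. Qed.

Definition Delta (R : pzRingType) : set R :=
  [set a | forall u : R, units u -> units (1 - u * a)].

Definition sqrt_Delta (R : pzRingType) : set R :=
  [set x | exists m : nat, (0 < m)%N /\ Delta (x ^+ m)].

Definition sqrt_Delta_fine (R : pzRingType) (r : R) : Prop :=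
  r <> 0 /\ exists u a : R, [/\ units u, sqrt_Delta a & r = u + a].

Definition sqrt_Delta_fine_ring (R : pzRingType) : Prop :=
  forall r : R, r <> 0 -> sqrt_Delta_fine r.

Definition two_sided_ideal (R : pzRingType) (I : set R) : Prop :=
  [/\ I 0,
      forall x y, I x -> I y -> I (x - y),
      forall a x, I x -> I (a * x)
    & forall a x, I x -> I (x * a)].

Definition ideal_generated (R : pzRingType) (r : R) : set R :=
  smallest (@two_sided_ideal R) [set r].

Definition simple_ring (R : pzRingType) : Prop :=
  (1 : R) <> 0 /\
  forall I : set R, two_sided_ideal I -> I = [set 0] \/ I = setT.

(* Main.v *)
Require Import Defs.
From mathcomp Require Import all_boot all_algebra.
From mathcomp Require Import boolp classical_sets.

(* Let r = u + a with u a unit and a ^+ m in Delta, and let I be an ideal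
   containing r.  Modulo I, a is - u, so a ^+ m is the unit (- u) ^+ m; if w is
   the inverse of the latter, the unit 1 - w * a ^+ m lies in I. *)

Import GRing.Theory.
Local Open Scope ring_scope.

Section TwoSidedIdeal.
Variables (R : pzRingType) (I : set R).
Hypothesis idI : two_sided_ideal I.

Lemma two_sided_idealN x : I x -> I (- x).
Proof. by case: idI => I0 IB _ _ Ix; rewrite -[- x]sub0r; apply: IB. Qed.

Lemma two_sided_idealD x y : I x -> I y -> I (x + y).
Proof.
case: idI => _ IB _ _ Ix Iy; rewrite -[y]opprK.
exact/IB/two_sided_idealN.
Qed.

(** Induction replaces the usual factorization of a difference of powers, since [x] and [y] need not
    commute. *)
Lemma two_sided_ideal_subXX x y n : I (x - y) -> I (x ^+ n - y ^+ n).
Proof.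
case: idI => I0 _ Il Ir Ixy; elim: n => [|n IHn]; first by rewrite subrr.
suff -> : x ^+ n.+1 - y ^+ n.+1 = x * (x ^+ n - y ^+ n) + (x - y) * y ^+ n.
  by apply: two_sided_idealD; [apply: Il | apply: Ir].
by rewrite !exprS mulrBr mulrBl addrA subrK.
Qed.

Lemma two_sided_ideal_unit u : units u -> I u -> I = setT.
Proof.
case: idI => _ _ Il _ [v [vu _]] Iu; rewrite -subTset => x _.
by rewrite -[x]mulr1 -vu mulrA; apply: Il.
Qed.

Lemma two_sided_ideal_sqrt_Delta_fine r : sqrt_Delta_fine r -> I r -> I = setT.
Proof.
case=> _ [u [a [[v [vu uv]] [m [_ Dam]] ->]]] Iua.
(* Mutually inverse elements commute, so the product of the powers is the power of the product. *)
have mulXXN1 (x y : R) : x * y = 1 -> y * x = 1 -> (- x) ^+ m * (- y) ^+ m = 1.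
  move=> xy yx; rewrite -exprMn_comm ?mulrNN ?xy ?expr1n //.
  by rewrite /GRing.comm !mulrNN xy yx.
have Uw : units ((- v) ^+ m) by exists ((- u) ^+ m); split; apply: mulXXN1.
(* Writing 1 as [(- v) ^+ m * (- u) ^+ m] turns this unit into
   [(- v) ^+ m * ((- u) ^+ m - a ^+ m)]. *)
apply: (two_sided_ideal_unit _ (Dam _ Uw)); rewrite -(mulXXN1 _ _ vu uv) -mulrBr.
case: (idI) => _ _ Il _; apply/Il; rewrite -opprB.
by apply/two_sided_idealN/two_sided_ideal_subXX; rewrite opprK addrC.
Qed.

End TwoSidedIdeal.

Theorem proposition2p6 (R : nzRingType) :
  (forall r : R, sqrt_Delta_fine r -> ideal_generated r = setT) /\
  (sqrt_Delta_fine_ring R -> simple_ring R).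
Proof.
split=> [r fine_r | fineR].
  (* The generated ideal is an intersection: each ideal [I] containing [r] must be the whole
     ring. *)
  rewrite -subTset => x _ I [idI rI].
  by rewrite (two_sided_ideal_sqrt_Delta_fine _ _ idI _ fine_r) //; apply: rI.
split=> [|I idI]; first exact/eqP/oner_neq0.
(* Any nonzero member of [I] is fine and forces [I = setT]. *)
have [[r Ir r0] | I0] := pselect (exists2 r, I r & r <> 0); [right | left].
  exact: two_sided_ideal_sqrt_Delta_fine _ _ idI _ (fineR r r0) Ir.
apply/seteqP; split=> [x Ix | x -> /=]; last by case: idI.
by have [//|x0] := pselect (x = 0); case: I0; exists x.
Qed.
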